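(* Let $D$ be a mixed graph such that every cycle of even length in $D$ contains an even number of digons and every cycle of odd length in $D$ contains an odd number of digons. Then $\sigma_\gamma(D)=\sigma_\omega(D)$, where $\gamma=e^{2\pi i/3}$ and $\omega=e^{\pi i/3}$.
   Context: A mixed graph $D$ is obtained from a finite simple undirected graph $\Gamma(D)$ by replacing some edges by arcs: between any two adjacent vertices $u,v$ there is exactly one of a digon $u\sim v$, an arc $u\to v$, or an arc $v\to u$. Cycles refer to $\Gamma(D)$. For $|\alpha|=1$, $H^\alpha(D)=[h_{uv}]$ has $h_{uv}=1$ if $u\sim v$, $\alpha$ if $u\to v$, $\bar\alpha$ if $v\to u$, $0$ otherwise, and $\sigma_\alpha(D)$ is its multiset of eigenvalues. *)

(* Defs.v *)
From mathcomp Require Import all_boot all_order all_algebra.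
From mathcomp Require Import complex finmap multiset.
From mathcomp Require Import reals trigo.
Set Implicit Arguments.
Unset Strict Implicit.
Unset Printing Implicit Defensive.
Import Order.TTheory GRing.Theory Num.Theory.
Local Open Scope ring_scope.

(* [edge] is adjacency in the underlying simple graph; [arc u v] means u -> v.
   The edges carrying no arc are the digons. *)
Record mixed_graph (V : finType) := MixedGraph {
  edge : rel V;
  arc : rel V;
  edge_sym : symmetric edge;
  edge_irr : irreflexive edge;
  arc_edge : subrel arc edge;
  arc_asym : forall u v, arc u v -> ~~ arc v u
}.

Definition digon (V : finType) (D : mixed_graph V) (u v : V) : bool :=
  [&& edge D u v, ~~ arc D u v & ~~ arc D v u].

(* A cycle is the sequence of its distinct vertices in cyclic order; its length
   is [size c].  [ucycle] alone also accepts [::] and [:: u; v]. *)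
Definition is_cycle (V : finType) (D : mixed_graph V) (c : seq V) : Prop :=
  (3 <= size c)%N /\ ucycle (edge D) c.

Definition cycle_digons (V : finType) (D : mixed_graph V) (c : seq V) : nat :=
  count (fun u => digon D u (next c u)) c.

Definition herm_entry (C : numClosedFieldType) (alpha : C) (V : finType)
    (D : mixed_graph V) (u v : V) : C :=
  if digon D u v then 1
  else if arc D u v then alpha
  else if arc D v u then alpha^*
  else 0.

Definition herm_mx (C : numClosedFieldType) (alpha : C) (V : finType)
    (D : mixed_graph V) : 'M[C]_#|V| :=
  \matrix_(i, j) herm_entry alpha D (enum_val i) (enum_val j).

(* Eigenvalues with algebraic multiplicity: the factorization of the (monic)
   characteristic polynomial into linear factors. *)
Definition spectrum (C : closedFieldType) (n : nat) (A : 'M[C]_n) : {mset C}%mset :=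
  seq_mset (sval (closed_field_poly_normal (char_poly A))).

Lemma spectrumE (C : closedFieldType) (n : nat) (A : 'M[C]_n) (a : C) :
  spectrum A a = mup a (char_poly A).
Proof.
rewrite /spectrum mset_seqE; case: closed_field_poly_normal => r /= ->.
rewrite (monicP (char_poly_monic A)) scale1r.
by rewrite mu_prod_XsubC.
Qed.

Definition mixed_spectrum (C : numClosedFieldType) (alpha : C) (V : finType)
    (D : mixed_graph V) : {mset C}%mset :=
  spectrum (herm_mx alpha D).

(* e^{i theta} *)
Definition expi (R : realType) (theta : R) : R[i] :=
  Complex (cos theta) (sin theta).

(* Main.v *)
(** Since omega is the opposite of the conjugate of gamma, the transpose of
    [H^omega(D)] is [H^gamma(D)] with the entries of the arcs negated.  Expand
    both characteristic polynomials over permutations: a permutation with a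
    nonzero term splits into fixed points, edges traversed back and forth, and
    cycles of D, and the hypotheses say exactly that each of these carries an
    even number of arcs, so the signs cancel term by term. *)

From Pilot Require Import Defs.
From mathcomp Require Import all_boot all_order all_algebra.
From mathcomp Require Import perm complex finmap multiset.
From mathcomp Require Import reals trigo.
Local Open Scope ring_scope.
(* [arc] would otherwise denote [path.arc]. *)
Import Pilot.Defs.
Import Order.TTheory GRing.Theory Num.Theory.

Set Implicit Arguments.
Unset Strict Implicit.
Unset Printing Implicit Defensive.

Definition linked_by_arc (V : finType) (D : mixed_graph V) (u v : V) : bool :=
  arc D u v || arc D v u.

Lemma linked_by_arcC (V : finType) (D : mixed_graph V) (u v : V) :
  linked_by_arc D u v = linked_by_arc D v u.
Proof. by rewrite /linked_by_arc orbC. Qed.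

Lemma linked_by_arcxx (V : finType) (D : mixed_graph V) (v : V) :
  linked_by_arc D v v = false.
Proof.
by apply/negP; rewrite /linked_by_arc orbb => /arc_edge; rewrite edge_irr.
Qed.

Lemma linked_by_arcN (V : finType) (D : mixed_graph V) (u v : V) :
  edge D u v -> linked_by_arc D u v = ~~ digon D u v.
Proof. by rewrite /digon /linked_by_arc -negb_or => -> /=; rewrite negbK. Qed.

(** Every edge of a cycle is either a digon or an arc, so the arcs number the length minus the
    digons, and the hypotheses give these two the same parity. *)
Lemma cycle_arcs_even (V : finType) (D : mixed_graph V) (c : seq V) :
  (forall c, is_cycle D c -> ~~ odd (size c) -> ~~ odd (cycle_digons D c)) ->
  (forall c, is_cycle D c -> odd (size c) -> odd (cycle_digons D c)) ->
  is_cycle D c -> ~~ odd (count (fun u => linked_by_arc D u (next c u)) c).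
Proof.
move=> Heven Hodd cycc.
have -> : count (fun u => linked_by_arc D u (next c u)) c
        = count (predC (fun u => digon D u (next c u))) c.
  apply: eq_in_count => u uc /=; apply: linked_by_arcN.
  by case: cycc => _ /andP[cc _]; apply: next_cycle cc uc.
have := count_predC (fun u => digon D u (next c u)) c.
move/(congr1 odd); rewrite oddD -/(cycle_digons D c).
have -> : odd (cycle_digons D c) = odd (size c).
  case: (boolP (odd (size c))) => parity; first exact: Hodd.
  exact/negbTE/Heven.
by case: (odd (size c)); case: (odd _).
Qed.

(** An orbit of size one is a fixed point and carries no arc; one of size two runs along the same
    edge back and forth, so it counts 0 or 2; a longer one is a cycle of [D] on which [next] is
    [f]. *)
Lemma orbit_arcs_even (V : finType) (D : mixed_graph V) (f : V -> V) (x : V) :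
  (forall c, is_cycle D c -> ~~ odd (size c) -> ~~ odd (cycle_digons D c)) ->
  (forall c, is_cycle D c -> odd (size c) -> odd (cycle_digons D c)) ->
  injective f -> (forall v, f v != v -> edge D v (f v)) ->
  ~~ odd (count (fun u => linked_by_arc D u (f u)) (orbit f x)).
Proof.
move=> Heven Hodd injf edgef.
have fcyc := cycle_orbit injf x.
have uorb := orbit_uniq f x.
have nextf u : u \in orbit f x -> next (orbit f x) u = f u.
  by move=> ux; rewrite (eqP (next_cycle fcyc ux)).
case: (ltnP 2 (size (orbit f x))) => [big|]; last first.
  case: (orbit f x) fcyc => [|a [|b [|//]]] //=.
    by move=> /andP[/eqP -> _] _; rewrite linked_by_arcxx.
  move=> /and3P[/eqP fa /eqP fb _] _; rewrite fb fa (linked_by_arcC D b a).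
  by rewrite addn0 addnn odd_double.
have -> : count (fun u => linked_by_arc D u (f u)) (orbit f x)
  = count (fun u => linked_by_arc D u (next (orbit f x) u)) (orbit f x).
  by apply: eq_in_count => u ux /=; rewrite nextf.
apply: cycle_arcs_even => //; split=> //; apply/andP; split=> //.
apply: (@sub_in_cycle _ (mem (orbit f x)) (frel f)) (fcyc); last exact/allP.
(* A fixed point [u] would make the orbit of size one, against [big]; so every step of the orbit is
   an edge. *)
move=> u v ux _ /= /eqP <-; apply: edgef; apply/eqP => fu.
have fix_u : fcycle f [:: u] by rewrite /= fu eqxx.
have := big; rewrite size_orbit (eq_order_cycle fcyc ux (in_orbit f x)).
by rewrite (order_cycle fix_u) ?inE.
Qed.

Lemma injection_arcs_even (V : finType) (D : mixed_graph V) (f : V -> V) :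
  (forall c, is_cycle D c -> ~~ odd (size c) -> ~~ odd (cycle_digons D c)) ->
  (forall c, is_cycle D c -> odd (size c) -> odd (cycle_digons D c)) ->
  injective f -> (forall v, f v != v -> edge D v (f v)) ->
  ~~ odd (\sum_v linked_by_arc D v (f v))%N.
Proof.
move=> Heven Hodd injf edgef; rewrite -dvdn2.
(* The orbits of [f] partition [V] and are indexed by their roots; an [r] that is no root gives an
   empty sum. *)
rewrite (partition_big (froot f) predT) //=; apply: dvdn_sum => r _.
case: (pickP (fun v => froot f v == r)) => [x /eqP xr|none]; last first.
  by rewrite big_pred0.
rewrite (eq_bigl (mem (orbit f x))) => [|v]; last first.
  rewrite /= -fconnect_orbit -xr eq_sym root_connect //.
  exact: fconnect_sym.
rewrite -big_uniq ?orbit_uniq //= dvdn2.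
have := orbit_arcs_even x Heven Hodd injf edgef.
by rewrite -sumn_count sumnE big_map.
Qed.

(** The Leibniz terms agree for each permutation [s]: if [s] moves indices only along edges, it
    traverses an even number of arcs and the signs cancel; otherwise both terms vanish. *)
Lemma char_poly_arc_sign (C : comNzRingType) (V : finType) (D : mixed_graph V)
    (A B : 'M[C]_#|V|) :
  (forall c, is_cycle D c -> ~~ odd (size c) -> ~~ odd (cycle_digons D c)) ->
  (forall c, is_cycle D c -> odd (size c) -> odd (cycle_digons D c)) ->
  (forall i j, i != j -> ~~ edge D (enum_val i) (enum_val j) -> A i j = 0) ->
  (forall i j,
     B i j = (-1) ^+ linked_by_arc D (enum_val i) (enum_val j) * A i j) ->
  char_poly A = char_poly B.
Proof.
move=> Heven Hodd A0 BA; apply: eq_bigr => s _; congr (_ * _).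
have charBA i j : char_poly_mx B i j =
    (-1) ^+ linked_by_arc D (enum_val i) (enum_val j) * char_poly_mx A i j.
  rewrite !mxE BA; have [<-|_] := eqVneq i j.
    by rewrite linked_by_arcxx !mul1r.
  by rewrite !mulr0n !sub0r rmorphM rmorph_sign mulrN.
under [RHS]eq_bigr do rewrite charBA.
rewrite big_split /= prodrXr.
have [/forallP edges|] :=
    boolP [forall i : 'I_#|V|,
             (s i != i) ==> edge D (enum_val i) (enum_val (s i))].
  suff /negbTE even_arcs :
      ~~ odd (\sum_i linked_by_arc D (enum_val i) (enum_val (s i)))%N.
    by rewrite -signr_odd even_arcs mul1r.
  (* The permutation [s] of the indices, carried over to the vertices. *)
  pose f v := enum_val (s (enum_rank v)) : V.
  have -> : (\sum_i linked_by_arc D (enum_val i) (enum_val (s i)) =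
             \sum_v linked_by_arc D v (f v))%N.
    rewrite [RHS](reindex (@enum_val V V)) /=; last first.
      exact/onW_bij/enum_val_bij.
    by apply: eq_bigr => i _; rewrite /f enum_valK.
  apply: injection_arcs_even => // [u v /enum_val_inj/perm_inj/enum_rank_inj//|v].
  move=> fv; have /implyP := edges (enum_rank v); rewrite enum_rankK; apply.
  by apply: contraNneq fv => sv; rewrite /f sv enum_rankK.
(* Here [s] moves [i] along a non-edge: off the diagonal there is no ['X], so the factor at [i] is
   zero. *)
case/forallPn=> i; rewrite negb_imply => /andP[si nedge].
suff -> : \prod_j char_poly_mx A j (s j) = 0 by rewrite mulr0.
by rewrite (bigD1 i) //= !mxE A0 // 1?eq_sym // (negbTE si) mulr0n subr0 mul0r.
Qed.

Lemma char_poly_tr (C : comNzRingType) (n : nat) (A : 'M[C]_n) :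
  char_poly A^T = char_poly A.
Proof.
rewrite /char_poly -det_tr; congr (\det _).
by apply/matrixP => i j; rewrite !mxE eq_sym.
Qed.

Lemma herm_entry_nedge (C : numClosedFieldType) (alpha : C) (V : finType)
    (D : mixed_graph V) (u v : V) :
  ~~ edge D u v -> herm_entry alpha D u v = 0.
Proof.
move=> nuv; rewrite /herm_entry /digon (negbTE nuv) /=.
rewrite (contraNF (@arc_edge _ D u v) nuv).
by rewrite (contraNF (@arc_edge _ D v u)) // edge_sym.
Qed.

(** Swapping [u] and [v] conjugates the entry of an arc, which undoes the conjugation in
    [- alpha^*]; only the minus sign survives. *)
Lemma herm_entry_oppconj (C : numClosedFieldType) (alpha : C) (V : finType)
    (D : mixed_graph V) (u v : V) :
  herm_entry (- alpha^*) D v u =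
  (-1) ^+ linked_by_arc D u v * herm_entry alpha D u v.
Proof.
rewrite /herm_entry /digon /linked_by_arc (edge_sym D v u).
have [auv|_] := boolP (arc D u v).
  rewrite (negbTE (arc_asym auv)) /= !andbF /=.
  by rewrite rmorphN /= conjCK expr1 mulN1r.
by have [avu|_] := boolP (arc D v u); rewrite ?andbF ?andbT /= ?mulN1r ?mul1r.
Qed.

Lemma expi_pi_minus (R : realType) (theta : R) :
  expi (pi - theta) = - (expi theta)^*.
Proof.
by rewrite /expi addrC cosDpi sinDpi cosN sinN opprK; apply/eqP;
  rewrite eq_complex /= opprK !eqxx.
Qed.

Theorem theorem4p11 (R : realType) (V : finType) (D : mixed_graph V)
  (Heven : forall c : seq V,
     is_cycle D c -> ~~ odd (size c) -> ~~ odd (cycle_digons D c))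
  (Hodd : forall c : seq V,
     is_cycle D c -> odd (size c) -> odd (cycle_digons D c)) :
  mixed_spectrum (expi (2 * pi / 3 : R)) D = mixed_spectrum (expi (pi / 3 : R)) D.
Proof.
(* This form of the angle exhibits omega as minus the conjugate of gamma. *)
have -> : pi / 3 = pi - 2 * pi / 3 :> R.
  apply: (canLR (mulfK _)); rewrite ?pnatr_eq0 // mulrBl divfK ?pnatr_eq0 //.
  by rewrite mulrC -mulrBl -natrB // mul1r.
rewrite expi_pi_minus /mixed_spectrum /spectrum.
set g := expi _; suff -> : char_poly (herm_mx g D) =
                           char_poly (herm_mx (- g^*) D) by [].
(* After transposition the two matrices differ only by the signs of the arc entries. *)
rewrite -[RHS]char_poly_tr.
apply: (@char_poly_arc_sign _ _ D) => // i j.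
  by move=> _ nij; rewrite mxE herm_entry_nedge.
by rewrite !mxE herm_entry_oppconj.
Qed.
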